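(* Consider $d\ge2$ and assume that the kernels $k^j$ are translation invariant and have non-empty level sets on $\mathbb X^j$ for $j\in[d]$. Then the sensitivity of bootstrap dHSIC satisfies $$\Delta_T^{\mathbf b}:=\sup_{\mathbf b}\ \sup_{\substack{\mathcal X_n,\tilde{\mathcal X}_n:\\ d_{\mathrm{ham}}(\mathcal X_n,\tilde{\mathcal X}_n)\le1}}\big|\widehat{\mathrm{dHSIC}}(\mathcal X_n^{\mathbf b})-\widehat{\mathrm{dHSIC}}(\tilde{\mathcal X}_n^{\mathbf b})\big|\ \ge\ \frac38\sqrt{K_0},$$ where $\sup_{\mathbf b}$ is taken over all bootstrap resamplings $\mathbf b$ and $K_0=\prod_{j=1}^dK^j$.
   Context: Superscripts $j\in[d]=\{1,\dots,d\}$ are indices, not exponents, and $n$ is the sample size, with $[n]=\{1,\dots,n\}$. For each $j$, $\mathbb X^j$ is a separable topological space and $k^j:\mathbb X^j\times\mathbb X^j\to\mathbb R$ is a continuous, bounded, positive semi-definite kernel with reproducing kernel Hilbert space $\mathcal H^j$ and $0\le k^j(x,x')\le K^j$ for all $x,x'\in\mathbb X^j$. Translation invariant means that there exists a symmetric positive definite function $\kappa^j$ with $k^j(x,x')=\kappa^j(x-x')$ for all $x,x'\in\mathbb X^j$. Non-empty level sets on $\mathbb X^j$ means that for any $\varepsilon\in(0,K^j)$ there exist $x,x'\in\mathbb X^j$ with $k^j(x,x')\le\varepsilon$. The tensor product kernel $\mathbf k((x^1,x'^1),\dots,(x^d,x'^d))=\prod_{j=1}^d k^j(x^j,x'^j)$,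 with RKHS $\mathcal H_{\mathbf k}=\mathcal H^1\otimes\dots\otimes\mathcal H^d$ and unit ball $\mathcal F_{\mathbf k}$ of $\mathcal H_{\mathbf k}$, is assumed characteristic (its mean embedding of probability distributions is injective). For a dataset $\mathcal X_n=(\mathbf X_1,\dots,\mathbf X_n)$ with $\mathbf X_i=(X_i^1,\dots,X_i^d)\in\mathbb X^1\times\dots\times\mathbb X^d$, $$\widehat{\mathrm{dHSIC}}(\mathcal X_n)=\sup_{f\in\mathcal F_{\mathbf k}}\Big\{\frac1n\sum_{i=1}^nf(X_i^1,\dots,X_i^d)-\frac1{n^d}\sum_{(i_1,\dots,i_d)\in[n]^d}f(X_{i_1}^1,\dots,X_{i_d}^d)\Big\}.$$ A bootstrap resampling is $\mathbf b=(b^1,\dots,b^d)$ with arbitrary maps $b^j:[n]\to[n]$; the resampled dataset $\mathcal X_n^{\mathbf b}$ has $i$-th element $(X^1_{b^1(i)},\dots,X^d_{b^d(i)})$. The Hamming distance is $d_{\mathrm{ham}}(\mathcal X_n,\tilde{\mathcal X}_n)=\sum_{i=1}^n\mathbb 1(\mathbf X_i\ne\tilde{\mathbf X}_i)$.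
   Formalization: The formal statement additionally assumes that each bound K^j is sharp (K^j is the supremum of k^j) and that the sample size is n ≥ 2; the claim is false for non-sharp bounds (Gaussian kernel with K^j = 100) and for n = 1, where dHSIC vanishes identically. *)

(* Defs.v *)
From HB Require Import structures.
From mathcomp Require Import all_boot all_order all_algebra.
From mathcomp Require Import sesquilinear.
From mathcomp Require Import all_classical all_reals all_analysis.

Set Implicit Arguments.
Unset Strict Implicit.
Unset Printing Implicit Defensive.

Import Order.TTheory GRing.Theory Num.Theory.
Import numFieldNormedType.Exports.

Local Open Scope classical_set_scope.
Local Open Scope ring_scope.

Definition separable_space (T : topologicalType) : Prop :=
  exists2 S : set T, countable S & dense S.

Definition psd_kernel (R : realType) (T : Type) (k : T -> T -> R) : Prop :=
  (forall x y, k x y = k y x) /\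
  (forall (m : nat) (x : 'I_m -> T) (c : 'I_m -> R),
     0 <= \sum_i \sum_j c i * c j * k (x i) (x j)).

(* "Positive definite" in the sense of Bochner's theorem: the quadratic forms
   are required to be nonnegative, not strictly positive. *)
Definition symmetric_pd_function (R : realType) (G : zmodType)
    (kappa : G -> R) : Prop :=
  (forall z, kappa (- z) = kappa z) /\
  (forall (m : nat) (z : 'I_m -> G) (c : 'I_m -> R),
     0 <= \sum_i \sum_j c i * c j * kappa (z i - z j)).

(* The difference [x - x'] is formed in an abelian group [G] of which [T] is
   a subset through the injection [iota] ([G = T] and [iota = id] is allowed;
   so is, say, a box [T] in [G = R^p]). *)
Definition translation_invariant (R : realType) (T : Type) (G : zmodType)
    (iota : T -> G) (k : T -> T -> R) : Prop :=
  exists kappa : G -> R, symmetric_pd_function kappa /\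
    forall x x', k x x' = kappa (iota x - iota x').

Definition nonempty_level_sets (R : realType) (T : Type)
    (k : T -> T -> R) (K : R) : Prop :=
  forall e : R, 0 < e < K -> exists x x', k x x' <= e.

(* A Hilbert space of real functions on [T] with the reproducing property for
   [k]: [rkhs_eval] turns a vector into the function it is, and being injective
   makes the vectors genuine functions; [rkhs_section x] is [k(x, .)]. By
   Moore-Aronszajn, every positive semi-definite [k] has such a space, unique
   up to a linear isometry preserving [rkhs_eval]. *)
Record rkhs (R : realType) (T : Type) (k : T -> T -> R) := RKHS {
  rkhs_space :> completeNormedModType R ;
  rkhs_dot : {dot rkhs_space for @idfun R} ;
  rkhs_norm_dot : forall f : rkhs_space, `|f| ^+ 2 = rkhs_dot f f ;
  rkhs_eval : rkhs_space -> T -> R ;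
  rkhs_eval_linear : forall (a : R) (f g : rkhs_space) (x : T),
    rkhs_eval (a *: f + g) x = a * rkhs_eval f x + rkhs_eval g x ;
  rkhs_eval_inj : injective rkhs_eval ;
  rkhs_section : T -> rkhs_space ;
  rkhs_sectionE : forall x : T, rkhs_eval (rkhs_section x) = k x ;
  rkhs_reproducing : forall (f : rkhs_space) (x : T),
    rkhs_dot f (rkhs_section x) = rkhs_eval f x }.

Definition rkhs_unit_ball (R : realType) (T : Type) (k : T -> T -> R)
    (H : rkhs k) : set H := [set f | `|f| <= 1].
Arguments rkhs_unit_ball {R T k} H _.

HB.instance Definition _ (I : Type) (X : I -> ptopologicalType) :=
  Pointed.copy (prod_topology X) (forall i, X i).

Notation borelType T := (g_sigma_algebraType (@open T)).

(* The embedding [\int k(x, .) dP(x)] is an element of the RKHS, hence given by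
   its values. *)
Definition mean_embedding (R : realType) (T : ptopologicalType)
    (k : T -> T -> R) (P : probability (borelType T) R) : T -> R :=
  fun y => Rintegral P setT (fun x => k x y).

(* Two measures are identified when they agree on the Borel sets. *)
Definition characteristic (R : realType) (T : ptopologicalType)
    (k : T -> T -> R) : Prop :=
  forall P Q : probability (borelType T) R,
    mean_embedding k P = mean_embedding k Q ->
    forall A : set (borelType T), measurable A -> P A = Q A.

Definition tensor_kernel (R : realType) (d : nat) (X : 'I_d -> Type)
    (k : forall j, X j -> X j -> R) (x x' : forall j, X j) : R :=
  \prod_j k j (x j) (x' j).

Definition dataset (d : nat) (X : 'I_d -> Type) (n : nat) :=
  'I_n -> forall j, X j.

Definition hamming (d : nat) (X : 'I_d -> Type) (n : nat)
    (D D' : dataset X n) : nat :=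
  (\sum_(i < n) `[< D i <> D' i >])%N.

Definition resampling (d n : nat) := 'I_d -> 'I_n -> 'I_n.

Definition resample (d : nat) (X : 'I_d -> Type) (n : nat)
    (b : resampling d n) (D : dataset X n) : dataset X n :=
  fun i j => D (b j i) j.

(* The real [sup] is a genuine supremum here: the set contains 0 and, for a
   bounded kernel, evaluation is bounded on the unit ball of the RKHS. *)
Definition dHSIC (R : realType) (d : nat) (X : 'I_d -> Type)
    (k : forall j, X j -> X j -> R) (H : rkhs (tensor_kernel k)) (n : nat)
    (D : dataset X n) : R :=
  sup [set n%:R^-1 * (\sum_(i < n) rkhs_eval f (D i))
           - (n%:R ^+ d)^-1 *
             (\sum_(s : {ffun 'I_d -> 'I_n}) rkhs_eval f (fun j => D (s j) j))
      | f in rkhs_unit_ball H].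

Definition dHSIC_sensitivity (R : realType) (d : nat) (X : 'I_d -> Type)
    (k : forall j, X j -> X j -> R) (H : rkhs (tensor_kernel k)) (n : nat)
    : \bar R :=
  ereal_sup [set
    ereal_sup [set (`|dHSIC H (resample b DD.1) - dHSIC H (resample b DD.2)|)%:E
              | DD in [set DD : dataset X n * dataset X n |
                       (hamming DD.1 DD.2 <= 1)%N]]
    | b in [set: resampling d n]].

(* Main.v *)
Require Import Defs.
From mathcomp Require Import all_boot all_order all_algebra.
From mathcomp Require Import sesquilinear ring lra zify.
From mathcomp Require Import all_classical all_reals all_analysis.

Set Implicit Arguments.
Unset Strict Implicit.
Unset Printing Implicit Defensive.

Import Order.TTheory GRing.Theory Num.Theory.
Import numFieldNormedType.Exports.

Local Open Scope classical_set_scope.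
Local Open Scope ring_scope.

(** The supremum is already large for a dataset of two kinds of points.  Let
    all samples but one equal [x], and let the remaining one equal [x] except
    in two coordinates [j0] and [j1], where it takes values [y] that the
    kernels hardly relate to those of [x].  A resampling may draw this
    exceptional sample for half of the indices, in all coordinates at once:
    the empirical law becomes a mixture with weights [p] and [q = 1 - p], as
    close to [1/2] as [n] allows, under which the coordinates [j0] and [j1] are perfectly
    dependent.  Replacing the exceptional sample by [x] makes the data
    constant, for which dHSIC vanishes.  So one change of a sample moves dHSIC
    from [0] to its value on the mixture.

    That value is bounded below by one test function, the alternating sum [f]
    of the kernel sections at the four points with coordinates in
    [{x, y} * {x, y}] at [(j0, j1)].  As the tensor kernel is a product, [f] is
    a product of functions of one coordinate ([rkhs_contrast_eval]), and the
    mean minus the product mean of a product function over the two blocks is a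
    covariance ([independence_gap_two_blocks]).  It equals [p * q * `|f|^2],
    so dHSIC is at least [p * q * `|f|].

    Translation invariance makes the kernels constant, equal to their bound
    [K j], on the diagonal ([translation_invariant_diag]); hence
    [`|f|^2 = 4 (K j0 - e0) (K j1 - e1) \prod_(j != j0, j1) K j], where
    [ei] is the kernel value at the pair of [x] and [y].  Since [n >= 2] gives
    [p * q >= 2/9] (the worst case is [n = 3]), points with
    [ei <= 5/32 * K ji] give the constant [2/9 * 2 * (1 - 5/32) = 3/8]. *)

(** * Reproducing kernel Hilbert spaces *)

Section RKHS.
Context {R : realType} {T : Type} {k : T -> T -> R}.
Variable H : rkhs k.

Lemma rkhs_evalD (f g : H) x :
  rkhs_eval (f + g) x = rkhs_eval f x + rkhs_eval g x.
Proof. by rewrite -[f in LHS]scale1r rkhs_eval_linear mul1r. Qed.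

Lemma rkhs_eval0 x : rkhs_eval (0 : H) x = 0.
Proof. by apply: (addrI (rkhs_eval (0 : H) x)); rewrite -rkhs_evalD !addr0. Qed.

Lemma rkhs_evalZ a (f : H) x : rkhs_eval (a *: f) x = a * rkhs_eval f x.
Proof. by rewrite -[a *: f]addr0 rkhs_eval_linear rkhs_eval0 addr0. Qed.

Lemma rkhs_evalN (f : H) x : rkhs_eval (- f) x = - rkhs_eval f x.
Proof. by rewrite -scaleN1r rkhs_evalZ mulN1r. Qed.

(** Expanding [`|f - k(x, .)|^2 >= 0] bounds evaluation without a square
    root; this weak form of Cauchy-Schwarz suffices for suprema over the unit
    ball to be finite. *)
Lemma rkhs_eval_le (f : H) x : 2 * rkhs_eval f x <= `|f| ^+ 2 + k x x.
Proof.
have : 0 <= `|f - rkhs_section H x| ^+ 2 by exact: exprn_ge0.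
rewrite !rkhs_norm_dot linearBl /= !linearBr /= !rkhs_reproducing.
rewrite (hermC (rkhs_dot H) (rkhs_section H x) f) /= mul1r rkhs_reproducing rkhs_sectionE.
lra.
Qed.

Lemma rkhs_eval_norm_le (f : H) x :
  `|f| <= 1 -> `|rkhs_eval f x| <= (1 + k x x) / 2.
Proof.
move=> f1.
have f2 : `|f| ^+ 2 <= 1 by rewrite expr_le1.
have := rkhs_eval_le f x; have := rkhs_eval_le (- f) x.
by rewrite normrN rkhs_evalN ler_norml => ? ?; apply/andP; split; lra.
Qed.

End RKHS.

(** * Mean and product mean of a function over a dataset *)

Section Gap.
Context {R : realType} {d : nat} {X : 'I_d -> Type} {n : nat}.
Implicit Types (D : dataset X n) (g : (forall j, X j) -> R).

(** The quantity whose supremum over the unit ball is dHSIC. *)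
Definition independence_gap D g : R :=
  n%:R^-1 * (\sum_(i < n) g (D i))
  - (n%:R ^+ d)^-1 *
    (\sum_(s : {ffun 'I_d -> 'I_n}) g (fun j => D (s j) j)).

Lemma eq_independence_gap D g g' :
  g =1 g' -> independence_gap D g = independence_gap D g'.
Proof. by move=> /funext ->. Qed.

Lemma independence_gapZ D a g :
  independence_gap D (fun w => a * g w) = a * independence_gap D g.
Proof. by rewrite /independence_gap -!mulr_sumr; ring. Qed.

Lemma independence_gap_bounded D M :
  exists B, forall g, (forall w, `|g w| <= M) -> independence_gap D g <= B.
Proof.
exists (n%:R^-1 * (\sum_(i < n) M)
        + (n%:R ^+ d)^-1 * (\sum_(s : {ffun 'I_d -> 'I_n}) M)) => g gM.
have gM' w : - M <= g w <= M by rewrite -ler_norml.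
rewrite /independence_gap -mulrN lerD// ler_wpM2l ?invr_ge0 ?exprn_ge0//.
  by apply: ler_sum => i _; case/andP: (gM' (D i)).
rewrite -sumrN; apply: ler_sum => s _; rewrite lerNl.
by case/andP: (gM' (fun j => D (s j) j)).
Qed.

Lemma independence_gap_cst (x : forall j, X j) g :
  (0 < n)%N -> independence_gap (fun=> x) g = 0.
Proof.
move=> n0; rewrite /independence_gap !sumr_const card_ffun !card_ord.
rewrite -(mulr_natr (g x) n) -(mulr_natr (g x) (n ^ d)) natrX [X in X - _]mulrCA [X in _ - X]mulrCA.
have n1 : n%:R != 0 :> R by rewrite pnatr_eq0 -lt0n.
by rewrite !mulVf ?expf_neq0// subrr.
Qed.

Lemma independence_gap_prod D (g : forall j, X j -> R) :
  independence_gap D (fun w => \prod_j g j (w j)) =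
  n%:R^-1 * (\sum_(i < n) \prod_j g j (D i j))
  - \prod_j (n%:R^-1 * \sum_(i < n) g j (D i j)).
Proof.
rewrite /independence_gap big_split /= prodr_const card_ord exprVn.
by rewrite (bigA_distr_bigA (fun j i => g j (D i j))).
Qed.

End Gap.

Section TwoBlocks.
Context {R : realType} {d : nat} {X : 'I_d -> Type}.
Variables (j0 j1 : 'I_d) (j01 : j0 != j1).

Lemma prodD2 (F : 'I_d -> R) :
  \prod_j F j = F j0 * F j1 * \prod_(j | (j != j0) && (j != j1)) F j.
Proof.
by rewrite (bigD1 j0)//= (bigD1 j1) 1?eq_sym//= mulrA.
Qed.

Lemma sum_two_blocks n m (a b : R) : (m <= n)%N ->
  \sum_(i < n) (if (i < m)%N then a else b) = m%:R * a + (n%:R - m%:R) * b.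
Proof.
move=> mn; rewrite -(big_mkord xpredT (fun i => if (i < m)%N then a else b)).
rewrite (big_cat_nat (n := m))//= -natrB// !mulr_natl.
rewrite (eq_big_nat _ _ (F2 := fun=> a)); last by move=> i /andP[_ ->].
rewrite (@eq_big_nat _ _ _ m n _ (fun=> b)); last first.
  by move=> i /andP[mi _]; rewrite ltnNge mi.
by rewrite !sumr_const_nat subn0.
Qed.

(** The coordinates outside [j0] and [j1] are constant over the data and
    factor out; what remains is the covariance of two functions of one
    Bernoulli variable of parameter [m / n]. *)
Lemma independence_gap_two_blocks n m (y x : forall j, X j)
    (g : forall j, X j -> R) :
  (0 < n)%N -> (m <= n)%N -> (forall j, j != j0 -> j != j1 -> y j = x j) ->
  independence_gap (fun i : 'I_n => if (i < m)%N then y else x)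
    (fun w => \prod_j g j (w j)) =
  m%:R * (n%:R - m%:R) / n%:R ^+ 2 *
  ((g j0 (y j0) - g j0 (x j0)) * (g j1 (y j1) - g j1 (x j1)) *
   \prod_(j | (j != j0) && (j != j1)) g j (x j)).
Proof.
move=> n0 mn yx.
have n1 : n%:R != 0 :> R by rewrite pnatr_eq0 -lt0n.
have meanE j : \sum_(i < n) g j ((if (i < m)%N then y else x) j) =
               m%:R * g j (y j) + (n%:R - m%:R) * g j (x j).
  by rewrite -sum_two_blocks//; apply: eq_bigr => i _; case: ifP.
have prod_meanE : \sum_(i < n) \prod_j g j ((if (i < m)%N then y else x) j) =
    m%:R * \prod_j g j (y j) + (n%:R - m%:R) * \prod_j g j (x j).
  by rewrite -sum_two_blocks//; apply: eq_bigr => i _; case: ifP.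
rewrite independence_gap_prod prod_meanE.
under [X in _ - X]eq_bigr => j _ do rewrite meanE.
rewrite !prodD2.
rewrite [X in m%:R * (_ * X)](eq_bigr (fun j => g j (x j))); last first.
  by move=> j /andP[jj0 jj1]; rewrite yx.
rewrite [X in _ - _ * X](eq_bigr (fun j => g j (x j))); last first.
  by move=> j /andP[jj0 jj1]; rewrite yx//; field.
by field.
Qed.

End TwoBlocks.

(** * Lower bounds for dHSIC and for its sensitivity *)

Section DHSIC.
Context {R : realType} {d n : nat} {X : 'I_d -> Type}.
Context {k : forall j, X j -> X j -> R}.
Variable H : rkhs (tensor_kernel k).

Lemma dHSIC_ge (B : R) (f : H) (D : dataset X n) :
  (forall x, tensor_kernel k x x <= B) -> `|f| <= 1 ->
  independence_gap D (rkhs_eval f) <= dHSIC H D.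
Proof.
move=> kB f1; apply: ub_le_sup; last by exists f.
have [M gapM] := independence_gap_bounded D ((1 + B) / 2).
exists M => _ [g g1 <-]; apply: gapM => w.
apply: le_trans (rkhs_eval_norm_le w g1) _.
by rewrite ler_pM2r ?invr_gt0// lerD2l.
Qed.

Lemma dHSIC_ge_normalized (B : R) (f : H) (D : dataset X n) :
  (forall x, tensor_kernel k x x <= B) -> 0 < `|f| ->
  independence_gap D (rkhs_eval f) / `|f| <= dHSIC H D.
Proof.
move=> kB f0; have := @dHSIC_ge B (`|f|^-1 *: f) D kB.
rewrite normrZ normfV normr_id mulVf ?gt_eqF// lexx => /(_ isT).
rewrite (eq_independence_gap _ (rkhs_evalZ _ _)) independence_gapZ.
by rewrite mulrC.
Qed.

Lemma dHSIC_cst (x : forall j, X j) :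
  (0 < n)%N -> dHSIC H (fun _ : 'I_n => x) = 0.
Proof.
move=> n0; rewrite /dHSIC -[RHS](@sup1 R); congr (sup _).
apply/seteqP; split=> [_ [f _ <-]|_ ->] /=.
  exact: (independence_gap_cst x (rkhs_eval f)).
exists 0; first by rewrite /rkhs_unit_ball /= normr0.
exact: (independence_gap_cst x (rkhs_eval (0 : H))).
Qed.

Lemma dHSIC_sensitivity_ge (b : resampling d n) (D D' : dataset X n) :
  (hamming D D' <= 1)%N ->
  (`|dHSIC H (resample b D) - dHSIC H (resample b D')|%:E
     <= dHSIC_sensitivity H n)%E.
Proof.
move=> DD'; apply: le_trans (ereal_sup_ubound _); last by exists b.
by apply: ereal_sup_ubound; exists (D, D').
Qed.

Lemma dHSIC_sensitivity_ge0 (x : forall j, X j) :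
  (0%:E <= dHSIC_sensitivity H n)%E.
Proof.
apply: le_trans (@dHSIC_sensitivity_ge (fun=> id) (fun=> x) (fun=> x) _).
  by rewrite lee_fin.
by rewrite /hamming big1// => i _; case: asboolP.
Qed.

(** Two datasets that differ in the sample [0] alone become, when the first [m]
    indices draw this sample and the others draw the sample [1], two blocks
    and constant data. *)
Lemma dHSIC_sensitivity_ge_two_blocks (y x : forall j, X j) (m : nat) :
  (2 <= n)%N ->
  ((dHSIC H (fun i : 'I_n => if (i < m)%N then y else x))%:E
     <= dHSIC_sensitivity H n)%E.
Proof.
move=> n2.
pose i0 : 'I_n := Ordinal (ltnW n2); pose i1 : 'I_n := Ordinal n2.
pose D : dataset X n := fun i => if i == i0 then y else x.
pose b : resampling d n := fun=> fun i => if (i < m)%N then i0 else i1.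
have DD' : (hamming D (fun=> x) <= 1)%N.
  rewrite /hamming (bigD1 i0)//= big1 ?addn0 ?leq_b1// => i /negPf ii0.
  by rewrite /D ii0; case: asboolP.
have := dHSIC_sensitivity_ge b DD'.
rewrite (_ : resample b D = fun i => if (i < m)%N then y else x); last first.
  apply/funext => i; apply: functional_extensionality_dep => j.
  by rewrite /resample /b /D; case: (i < m)%N; rewrite ?eqxx.
rewrite (_ : resample b _ = fun=> x)// dHSIC_cst ?(ltnW n2)// subr0.
by apply: le_trans; rewrite lee_fin ler_norm.
Qed.

End DHSIC.

(** * The alternating sum of four kernel sections *)

Section Contrast.
Context {R : realType} {d : nat} {X : 'I_d -> Type}.
Variables (k : forall j, X j -> X j -> R) (H : rkhs (tensor_kernel k)).
Variables (x y : forall j, X j) (j0 j1 : 'I_d).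
Hypothesis j01 : j0 != j1.

Definition corner (a b : bool) (j : 'I_d) : X j :=
  if (j == j0) && a || (j == j1) && b then y j else x j.

Definition rkhs_contrast : H :=
  rkhs_section H (corner false false) - rkhs_section H (corner true false)
  - rkhs_section H (corner false true) + rkhs_section H (corner true true).

Definition contrast_factor (j : 'I_d) (w : X j) : R :=
  if (j == j0) || (j == j1) then k (x j) w - k (y j) w else k (x j) w.

Lemma corner0 a b : corner a b j0 = if a then y j0 else x j0.
Proof. by rewrite /corner eqxx (negPf j01) andFb orbF. Qed.

Lemma corner1 a b : corner a b j1 = if b then y j1 else x j1.
Proof. by rewrite /corner eqxx [j1 == j0]eq_sym (negPf j01). Qed.

Lemma corner_other a b j : j != j0 -> j != j1 -> corner a b j = x j.
Proof. by rewrite /corner => /negPf -> /negPf ->. Qed.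

Lemma tensor_kernel_corner a b w :
  tensor_kernel k (corner a b) w =
  k (if a then y j0 else x j0) (w j0) * k (if b then y j1 else x j1) (w j1) *
  \prod_(j | (j != j0) && (j != j1)) k (x j) (w j).
Proof.
rewrite /tensor_kernel (prodD2 j01) corner0 corner1; congr (_ * _).
by apply: eq_bigr => j /andP[? ?]; rewrite corner_other.
Qed.

Lemma prod_contrast_factor (w : forall j, X j) :
  \prod_j contrast_factor (w j) =
  (k (x j0) (w j0) - k (y j0) (w j0)) * (k (x j1) (w j1) - k (y j1) (w j1)) *
  \prod_(j | (j != j0) && (j != j1)) k (x j) (w j).
Proof.
rewrite (prodD2 j01) /contrast_factor !eqxx orbT; congr (_ * _).
by apply: eq_bigr => j /andP[/negPf -> /negPf ->].
Qed.

Lemma rkhs_contrast_eval (w : forall j, X j) :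
  rkhs_eval rkhs_contrast w = \prod_j contrast_factor (w j).
Proof.
rewrite /rkhs_contrast !(rkhs_evalD, rkhs_evalN) !rkhs_sectionE.
by rewrite !tensor_kernel_corner prod_contrast_factor; ring.
Qed.

(** By reproduction, the squared norm is the alternating sum of the values of
    the contrast at the four corners, which factorizes again. *)
Lemma rkhs_contrast_norm :
  `|rkhs_contrast| ^+ 2 =
  (k (x j0) (x j0) - k (y j0) (x j0) - k (x j0) (y j0) + k (y j0) (y j0)) *
  (k (x j1) (x j1) - k (y j1) (x j1) - k (x j1) (y j1) + k (y j1) (y j1)) *
  \prod_(j | (j != j0) && (j != j1)) k (x j) (x j).
Proof.
have evalE a b : rkhs_eval rkhs_contrast (corner a b) =
    (k (x j0) (if a then y j0 else x j0) - k (y j0) (if a then y j0 else x j0)) *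
    (k (x j1) (if b then y j1 else x j1) - k (y j1) (if b then y j1 else x j1)) *
    \prod_(j | (j != j0) && (j != j1)) k (x j) (x j).
  rewrite rkhs_contrast_eval prod_contrast_factor corner0 corner1.
  by congr (_ * _); apply: eq_bigr => j /andP[? ?]; rewrite corner_other.
rewrite rkhs_norm_dot {2}/rkhs_contrast linearDr /= !linearBr /=.
by rewrite !rkhs_reproducing !evalE; ring.
Qed.

(** The contrast is the optimal test function up to a factor: the mean
    embeddings of the two-block law and of the product of its marginals differ
    by [m (n - m) / n^2] times the contrast, so pairing with it gives a multiple
    of its squared norm. *)
Lemma independence_gap_contrast n m : (0 < n)%N -> (m <= n)%N ->
  independence_gap (fun i : 'I_n => if (i < m)%N then corner true true else x)
    (rkhs_eval rkhs_contrast) =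
  m%:R * (n%:R - m%:R) / n%:R ^+ 2 * `|rkhs_contrast| ^+ 2.
Proof.
move=> n0 mn; rewrite (eq_independence_gap _ rkhs_contrast_eval).
rewrite (independence_gap_two_blocks j01)//; last exact: corner_other.
rewrite rkhs_contrast_norm corner0 corner1 /contrast_factor !eqxx orbT /=.
rewrite [X in _ * (_ * X)](eq_bigr (fun j => k (x j) (x j))).
  by ring.
by move=> j /andP[/negPf -> /negPf ->].
Qed.

End Contrast.

(** * Kernel values on the diagonal and block sizes *)

(** The quadratic form of [kappa] at the weights [1, -1] gives
    [kappa z <= kappa 0], so the supremum of the kernel is attained on the
    whole diagonal. *)
Lemma translation_invariant_diag (R : realType) (T : Type) (G : zmodType)
    (iota : T -> G) (k : T -> T -> R) (K : R) (x : T) :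
  translation_invariant iota k -> (forall x x', k x x' <= K) ->
  K = sup [set k p.1 p.2 | p in [set: T * T]] -> k x x = K.
Proof.
move=> [kappa [[kappaN kappa_psd] kE]] kK KE.
apply/eqP; rewrite eq_le kK /= KE; apply: ge_sup; first by exists (k x x), (x, x).
move=> _ [[u v] _ <-] /=; rewrite !kE.
have := kappa_psd 2 (fun i => if i == ord0 then iota u else iota v)
                    (fun i => if i == ord0 then 1 else -1).
rewrite !big_ord_recl !big_ord0 /= !subrr -[iota v - iota u]opprB kappaN.
lra.
Qed.

(** The worst case is [n = 3], with one third against two thirds. *)
Lemma half_split_ge (R : realFieldType) n : (2 <= n)%N ->
  2 / 9 <= n./2%:R * (n%:R - n./2%:R) / n%:R ^+ 2 :> R.
Proof.
move=> n2; rewrite ler_pdivlMr ?exprn_gt0 ?ltr0n ?(ltnW n2)//.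
have m1 : 1 <= n./2%:R :> R by rewrite ler1n; lia.
have -> : n%:R = (odd n)%:R + 2 * n./2%:R :> R.
  by rewrite -{1}(odd_double_half n) natrD -mul2n natrM.
by case: (odd n) => /=; nra.
Qed.

Theorem proposition3p2 (R : realType) (d n : nat)
    (X : 'I_d -> ptopologicalType)
    (G : 'I_d -> zmodType) (iota : forall j, X j -> G j)
    (k : forall j, X j -> X j -> R) (K : 'I_d -> R)
    (H : rkhs (tensor_kernel k))
    (X_separable : forall j, separable_space (X j))
    (iota_inj : forall j, injective (iota j))
    (k_continuous : forall j, continuous (fun p : X j * X j => k j p.1 p.2))
    (k_psd : forall j, psd_kernel (k j))
    (k_bounded : forall j (x x' : X j), 0 <= k j x x' <= K j)
    (K_sharp : forall j, K j = sup [set k j p.1 p.2 | p in [set: X j * X j]])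
    (k_characteristic :
       characteristic (T := prod_topology X) (tensor_kernel k))
    (d_ge2 : (2 <= d)%N) (n_ge2 : (2 <= n)%N)
    (k_translation_invariant : forall j, translation_invariant (iota j) (k j))
    (k_level_sets : forall j, nonempty_level_sets (k j) (K j)) :
  ((3 / 8 * Num.sqrt (\prod_(j < d) K j))%:E <= dHSIC_sensitivity H n)%E.
Proof.
have kdiag j (x : X j) : k j x x = K j.
  apply: translation_invariant_diag (k_translation_invariant j) _ (K_sharp j).
  by move=> u v; case/andP: (k_bounded j u v).
have K_ge0 j : 0 <= K j.
  by rewrite -(kdiag j point); case/andP: (k_bounded j point point).
(* A vanishing bound makes the claim trivial; level sets are informative only
   for positive bounds. *)
have [prod0|prodN0] := eqVneq (\prod_(j < d) K j) 0.
  rewrite prod0 sqrtr0 mulr0.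
  exact: dHSIC_sensitivity_ge0 (fun=> point).
have K_gt0 j : 0 < K j.
  by rewrite lt0r K_ge0 andbT; move/prodf_neq0: prodN0; apply.
(* The fraction c = 5/32 solves 2/9 * 2 * (1 - c) = 3/8; below, 27/16 is
   2 * (1 - c). *)
have far j : {p : X j * X j | k j p.1 p.2 <= 5 / 32 * K j}.
  apply: cid; have [|u [v uv]] := k_level_sets j (5 / 32 * K j).
    by by have K0 := K_gt0 j; apply/andP; split; lra.
  by exists (u, v).
pose x j := (sval (far j)).1; pose y j := (sval (far j)).2.
have kxy j : k j (x j) (y j) <= 5 / 32 * K j := svalP (far j).
pose j0 : 'I_d := Ordinal (ltnW d_ge2); pose j1 : 'I_d := Ordinal d_ge2.
have j01 : j0 != j1 by [].
pose f := rkhs_contrast H x y j0 j1.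
have f_norm : 27 / 16 * Num.sqrt (\prod_(j < d) K j) <= `|f|.
  have -> : `|f| = Num.sqrt (`|f| ^+ 2) by rewrite sqrtr_sqr normr_id.
  have -> : 27 / 16 = Num.sqrt ((27 / 16) ^+ 2) :> R.
    by rewrite sqrtr_sqr ger0_norm//; lra.
  rewrite -sqrtrM ?exprn_ge0//.
  rewrite ler_wsqrtr// rkhs_contrast_norm// (prodD2 j01).
  rewrite (eq_bigr (fun j => k j (x j) (x j))); last by move=> j _; rewrite kdiag.
  rewrite mulrA ler_wpM2r ?prodr_ge0//; first by move=> j _; rewrite kdiag.
  have kyx j : k j (y j) (x j) = k j (x j) (y j) by case: (k_psd j).
  rewrite !kdiag !kyx expr2 mulrACA ler_pM//;
    rewrite ?mulr_ge0//; try lra.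
  - by have := kxy j0; lra.
  - by have := kxy j1; lra.
have f_gt0 : 0 < `|f|.
  apply: lt_le_trans f_norm; rewrite mulr_gt0 ?sqrtr_gt0 ?prodr_gt0//; lra.
apply: le_trans
  (dHSIC_sensitivity_ge_two_blocks H (corner x y j0 j1 true true) x n./2 n_ge2).
rewrite lee_fin.
have kB z : tensor_kernel k z z <= \prod_j K j.
  by apply: ler_prod => j _; exact: k_bounded.
apply: le_trans (dHSIC_ge_normalized _ kB f_gt0).
rewrite independence_gap_contrast ?(ltnW n_ge2)//; last first.
  by rewrite -divn2 leq_div.
rewrite (expr2 `|_|) mulrA mulfK ?gt_eqF//.
have -> : 3 / 8 = 2 / 9 * (27 / 16) :> R by field.
rewrite -[X in X <= _]mulrA.
by apply: ler_pM; rewrite ?half_split_ge ?mulr_ge0 ?sqrtr_ge0.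
Qed.
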